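(* Let $m, n, r$ be positive integers such that $r < \min\{m,n\}$, and let $\mathbb{R}_{\le r}^{m \times n} := \{X \in \mathbb{R}^{m \times n} \mid \operatorname{rank} X \le r\}$. For every $X \in \mathbb{R}_{\le r}^{m \times n} \setminus \{0_{m \times n}\}$ and every $t_* \in (0,\infty)$, there exists $Z \in T_{\mathbb{R}_{\le r}^{m \times n}}(X)$ such that every selection of the set-valued map $$[0,\infty) \ni t \mapsto P_{\mathbb{R}_{\le r}^{m \times n}}(X+tZ) \subseteq \mathbb{R}_{\le r}^{m \times n}$$ is discontinuous at $t_*$.
   Context: The space $\mathbb{R}^{m \times n}$ is endowed with the Frobenius inner product $(X,Y) \mapsto \operatorname{tr} Y^\top X$ and the induced (Frobenius) norm $\|\cdot\|$; $0_{m \times n}$ is the zero matrix. Projection: for a nonempty closed subset $C$ of $\mathbb{R}^{m \times n}$ and $Y \in \mathbb{R}^{m \times n}$, $P_C(Y) := \operatorname{argmin}_{W \in C} \|Y-W\|$, which is a nonempty compact set. Tangent cone: for a nonempty closed subset $C$ of $\mathbb{R}^{m \times n}$ and $X \in C$, $T_C(X)$ is the set of all $V \in \mathbb{R}^{m \times n}$ for which there exist a sequence $(X_i)_{i \in \mathbb{N}}$ in $C$ converging to $X$ and a sequence $(t_i)_{i \in \mathbb{N}}$ in $(0,\infty)$ such that $\left(\frac{X_i-X}{t_i}\right)_{i \in \mathbb{N}}$ converges to $V$. Selection: a selection of the set-valued map $t \mapsto P_{\mathbb{R}_{\le r}^{m \times n}}(X+tZ)$ on $[0,\infty)$ is a function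 $s : [0,\infty) \to \mathbb{R}_{\le r}^{m \times n}$ such that $s(t) \in P_{\mathbb{R}_{\le r}^{m \times n}}(X+tZ)$ for all $t \in [0,\infty)$. *)

(* Defs.v *)
From HB Require Import structures.
From mathcomp Require Import all_boot all_order all_algebra.
From mathcomp Require Import all_classical all_reals all_analysis.

Set Implicit Arguments.
Unset Strict Implicit.
Unset Printing Implicit Defensive.

Import Order.TTheory GRing.Theory Num.Theory.
Import numFieldNormedType.Exports.

Local Open Scope classical_set_scope.
Local Open Scope ring_scope.

Definition frob_dot (R : realType) (m n : nat) (X Y : 'M[R]_(m, n)) : R :=
  \tr (Y^T *m X).

(* MathComp-Analysis norms matrices by the largest modulus of an entry, so
   [`|X|] is not the Frobenius norm.  Both norms induce the same topology, hence
   limits and continuity below use the library topology on matrices. *)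
Definition frob_norm (R : realType) (m n : nat) (X : 'M[R]_(m, n)) : R :=
  Num.sqrt (frob_dot X X).

Definition rank_le (R : realType) (m n r : nat) : set 'M[R]_(m, n) :=
  [set X | (\rank X <= r)%N].
Arguments rank_le R m n r : clear implicits.

Definition proj_set (R : realType) (m n : nat) (C : set 'M[R]_(m, n))
    (Y : 'M[R]_(m, n)) : set 'M[R]_(m, n) :=
  [set W | C W /\ forall W', C W' -> frob_norm (Y - W) <= frob_norm (Y - W')].

Definition tangent_cone (R : realType) (m n : nat) (C : set 'M[R]_(m, n))
    (X : 'M[R]_(m, n)) : set 'M[R]_(m, n) :=
  [set V | exists (X_ : nat -> 'M[R]_(m, n)) (t_ : nat -> R),
    [/\ forall i, C (X_ i),
        X_ i @[i --> \oo] --> X,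
        forall i, 0 < t_ i &
        (t_ i)^-1 *: (X_ i - X) @[i --> \oo] --> V]].

(* A function on [0, +oo) is encoded as a function on R whose values at negative
   arguments are unconstrained; its continuity is continuity relative to
   [0, +oo). *)
Definition is_selection (R : realType) (m n : nat)
    (S : R -> set 'M[R]_(m, n)) (s : R -> 'M[R]_(m, n)) : Prop :=
  forall t : R, `[0, +oo[%classic t -> S t (s t).

Definition continuous_at_nneg (R : realType) (m n : nat)
    (s : R -> 'M[R]_(m, n)) (t : R) : Prop :=
  s x @[x --> within `[0, +oo[%classic (nbhs t)] --> s t.

(* Main.v *)
(* The projection onto any set C is monotone: <Y1 - Y0, W1 - W0> >= 0 whenever
   Wi projects Yi.  Along t |-> X + t Z, if the projection at t* contains two
   points W0, W1 with <Z, W0> < <Z, W1>, then <Z, s t> is at most <Z, W0> for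
   t < t* and at least <Z, W1> for t > t*, whatever the selection s.

   To get two such points, choose Z so that Y = X + t* Z = P^T Q, where P and Q
   have r + 1 orthonormal rows.  All r + 1 nonzero singular values of Y are 1,
   so each P^T (1 - c^T c) Q with c a unit row is a projection of Y.  The first
   rho = rank X rows of P are taken in the column space of X, the last row of P
   is orthogonal to that space, and the last row q0 of Q is proportional to p X,
   where p is the first row of P.  Then Y - X has the form X A + B X + N with
   rank N <= r - rho, which makes Z tangent; and since p X q0^T != 0, <Z, .>
   takes different values on two of the projections. *)

Require Import Defs.
From HB Require Import structures.
From mathcomp Require Import all_boot all_order all_algebra.
From mathcomp Require Import all_classical all_reals all_analysis.
From mathcomp Require Import zify ring lra.

Set Implicit Arguments.
Unset Strict Implicit.
Unset Printing Implicit Defensive.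

Import Order.TTheory GRing.Theory Num.Theory.
Import numFieldNormedType.Exports.

Local Open Scope classical_set_scope.
Local Open Scope ring_scope.

(** * The Frobenius inner product *)

Lemma frob_dotE (R : realType) (m n : nat) (A B : 'M[R]_(m, n)) :
  frob_dot A B = \sum_j \sum_i A i j * B i j.
Proof.
rewrite /frob_dot /mxtrace; apply: eq_bigr => j _; rewrite mxE.
by apply: eq_bigr => i _; rewrite mxE mulrC.
Qed.

Lemma frob_dotC (R : realType) (m n : nat) (A B : 'M[R]_(m, n)) :
  frob_dot A B = frob_dot B A.
Proof. by rewrite /frob_dot -mxtrace_tr trmx_mul trmxK. Qed.

Lemma frob_dotDl (R : realType) (m n : nat) (A B C : 'M[R]_(m, n)) :
  frob_dot (A + B) C = frob_dot A C + frob_dot B C.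
Proof. by rewrite /frob_dot mulmxDr mxtraceD. Qed.

Lemma frob_dotZl (R : realType) (m n : nat) (a : R) (A C : 'M[R]_(m, n)) :
  frob_dot (a *: A) C = a * frob_dot A C.
Proof. by rewrite /frob_dot -scalemxAr mxtraceZ. Qed.

Lemma frob_dotBl (R : realType) (m n : nat) (A B C : 'M[R]_(m, n)) :
  frob_dot (A - B) C = frob_dot A C - frob_dot B C.
Proof. by rewrite -scaleN1r frob_dotDl frob_dotZl mulN1r. Qed.

Lemma frob_dotBr (R : realType) (m n : nat) (A B C : 'M[R]_(m, n)) :
  frob_dot A (B - C) = frob_dot A B - frob_dot A C.
Proof. by rewrite !(frob_dotC A) frob_dotBl. Qed.

Lemma frob_dotMtr (R : realType) (m n k : nat) (A : 'M[R]_(m, n))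
    (U : 'M[R]_(k, m)) (V : 'M[R]_(k, n)) :
  frob_dot A (U^T *m V) = \tr (U *m A *m V^T).
Proof. by rewrite /frob_dot trmx_mul trmxK -(mulmxA V^T) mxtrace_mulC. Qed.

Lemma frob_dot_ge0 (R : realType) (m n : nat) (A : 'M[R]_(m, n)) :
  0 <= frob_dot A A.
Proof.
rewrite frob_dotE sumr_ge0 // => j _; rewrite sumr_ge0 // => i _.
by rewrite -expr2 sqr_ge0.
Qed.

Lemma frob_dot_eq0 (R : realType) (m n : nat) (A : 'M[R]_(m, n)) :
  (frob_dot A A == 0) = (A == 0).
Proof.
apply/idP/eqP => [|->]; last by rewrite /frob_dot mulmx0 mxtrace0.
rewrite frob_dotE psumr_eq0 => [/allP A0|j _]; last first.
  by rewrite sumr_ge0 // => i _; rewrite -expr2 sqr_ge0.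
apply/matrixP => i j; rewrite mxE; have /= := A0 j (mem_index_enum j).
rewrite psumr_eq0 => [/allP /(_ i (mem_index_enum i))|i' _]; last first.
  by rewrite -expr2 sqr_ge0.
by rewrite /= mulf_eq0 orbb => /eqP.
Qed.

Lemma frob_norm_le (R : realType) (m n : nat) (A B : 'M[R]_(m, n)) :
  (frob_norm A <= frob_norm B) = (frob_dot A A <= frob_dot B B).
Proof. by rewrite /frob_norm ler_sqrt // frob_dot_ge0. Qed.

(** * Families of orthonormal rows *)

Lemma exists_unit_row (R : realType) (p n : nat) (A : 'M[R]_(p, n)) :
  A != 0 -> exists2 v : 'rV[R]_n, (v <= A)%MS & v *m v^T = 1%:M.
Proof.
move=> A0; set v := nz_row A.
have v0 : 0 < frob_dot v v.
  by rewrite lt_def frob_dot_eq0 nz_row_eq0 A0 frob_dot_ge0.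
have vv : v *m v^T = (frob_dot v v)%:M.
  by rewrite {1}[v *m _]mx11_scalar /frob_dot mxtrace_mulC trace_mx11.
exists ((Num.sqrt (frob_dot v v))^-1 *: v).
  by rewrite scalemx_sub // nz_row_sub.
rewrite linearZ /= -scalemxAl -scalemxAr scalerA vv scale_scalar_mx.
rewrite -invfM -expr2 sqr_sqrtr ?ltW // mulVf //; exact: lt0r_neq0.
Qed.

Lemma col_mx_orthonormal (R : realType) (k d n : nat)
    (U : 'M[R]_(k, n)) (V : 'M[R]_(d, n)) :
  U *m U^T = 1%:M -> V *m V^T = 1%:M -> U *m V^T = 0 ->
  col_mx U V *m (col_mx U V)^T = 1%:M.
Proof.
move=> UU VV UV; rewrite tr_col_mx mul_col_row UU VV UV scalar_mx_block.
by rewrite -[V *m U^T]trmxK trmx_mul trmxK UV trmx0.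
Qed.

(** Rows are added one at a time: as long as the rows found so far number fewer than [\rank A], a
    dimension count gives a nonzero vector of the row space of [A] orthogonal to all of them. *)
Lemma orthonormal_extend (R : realType) (k n p d : nat)
    (U : 'M[R]_(k, n)) (A : 'M[R]_(p, n)) :
  U *m U^T = 1%:M -> (k + d <= \rank A)%N ->
  exists V : 'M[R]_(d, n), [/\ (V <= A)%MS, V *m V^T = 1%:M & U *m V^T = 0].
Proof.
move=> UU; elim: d => [_|d IHd]; last rewrite -add1n => kd.
  exists 0; rewrite sub0mx trmx0 !mulmx0; split=> //.
  by apply/matrixP => - [].
have {IHd} [|V [VA VV UV]] := IHd; first by lia.
set W := col_mx U V.
have [|v] := @exists_unit_row _ _ _ (A :&: kermx W^T)%MS.
  rewrite -mxrank_eq0 -lt0n.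
  have := mxrank_sum_cap A (kermx W^T).
  have := rank_leq_col (A + kermx W^T)%MS.
  have := rank_leq_row W; have := rank_leq_col W.
  by rewrite mxrank_ker mxrank_tr; lia.
rewrite sub_capmx => /andP[vA /sub_kermxP].
rewrite tr_col_mx mul_mx_row -row_mx0 => /eq_row_mx[vU vV] vv.
exists (col_mx v V); split.
- by rewrite col_mx_sub vA.
- exact: col_mx_orthonormal.
- rewrite tr_col_mx mul_mx_row UV -[U *m _]trmxK trmx_mul trmxK vU trmx0.
  by rewrite row_mx0.
Qed.

(** * Projections of partial isometries *)

Lemma frob_dist_low_rank (R : realType) (m n k : nat) (P : 'M[R]_(k, m))
    (Q : 'M[R]_(k, n)) (W : 'M[R]_(m, n)) :
  P *m P^T = 1%:M -> Q *m Q^T = 1%:M -> (\rank W < k)%N ->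
  1 <= frob_dot (P^T *m Q - W) (P^T *m Q - W).
Proof.
move=> PP QQ rkW.
(* W kills some unit vector x^T of the row space of Q, and P^T Q is isometric
   on that space. *)
have [|c] := @exists_unit_row _ _ _ (kermx (Q *m W^T)).
  rewrite -mxrank_eq0 mxrank_ker subn_eq0 -ltnNge.
  by apply: leq_ltn_trans rkW; rewrite -(mxrank_tr W) mxrankM_maxr.
move=> /sub_kermxP; rewrite mulmxA => cW cc.
have Wx : W *m (c *m Q)^T = 0 by apply: trmx_inj; rewrite trmx_mul trmxK cW trmx0.
pose x := c *m Q; pose y := c *m P; set M := _ - W.
have xx : x *m x^T = 1%:M by rewrite trmx_mul mulmxA -(mulmxA c) QQ mulmx1.
have yy : y *m y^T = 1%:M by rewrite trmx_mul mulmxA -(mulmxA c) PP mulmx1.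
have Mx : M *m x^T = y^T.
  rewrite mulmxBl Wx subr0.
  by rewrite !trmx_mul !mulmxA -(mulmxA P^T) QQ mulmx1.
have yMx : frob_dot M (y^T *m x) = 1.
  by rewrite frob_dotMtr -mulmxA Mx yy mxtrace1.
have yxyx : frob_dot (y^T *m x) (y^T *m x) = 1.
  by rewrite frob_dotMtr mulmxA yy mul1mx xx mxtrace1.
(* Cauchy-Schwarz against the unit matrix [y^T *m x]: the square expands to [frob_dot M M - 1]. *)
clearbody M; have := frob_dot_ge0 (M - y^T *m x).
by rewrite frob_dotBl !frob_dotBr yxyx (frob_dotC _ M) yMx subrr subr0 subr_ge0.
Qed.

(** The residual [(c *m P)^T *m (c *m Q)] has norm 1, which meets the lower bound of
    [frob_dist_low_rank]. *)
Lemma partial_isometry_proj (R : realType) (m n k r : nat) (P : 'M[R]_(k, m))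
    (Q : 'M[R]_(k, n)) (c : 'rV[R]_k) :
  P *m P^T = 1%:M -> Q *m Q^T = 1%:M -> k = r.+1 -> c *m c^T = 1%:M ->
  proj_set (rank_le R m n r) (P^T *m Q) (P^T *m (1%:M - c^T *m c) *m Q).
Proof.
move=> PP QQ kr cc; split=> [|W /= rkW].
  rewrite /rank_le /=; apply: leq_trans (mxrankM_maxl _ _) _.
  apply: leq_trans (mxrankM_maxr _ _) _; rewrite -ltnS -kr.
  (* The middle factor is singular, since the nonzero row [c] kills it from the left. *)
  rewrite ltn_neqAle rank_leq_row andbT; apply/negP => /row_freeP[B].
  move/(congr1 (mulmx c)); rewrite mulmxA mulmxBr mulmx1 mulmxA cc mul1mx.
  rewrite subrr mul0mx => c0; move: cc; rewrite -c0 mul0mx => /matrixP.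
  by move=> /(_ 0 0)/eqP; rewrite !mxE eq_sym oner_eq0.
rewrite frob_norm_le; apply: (@le_trans _ _ 1); last first.
  by apply: frob_dist_low_rank; rewrite // kr ltnS.
rewrite mulmxBr mulmx1 mulmxBl opprB addrC subrK.
have -> : P^T *m (c^T *m c) *m Q = (c *m P)^T *m (c *m Q).
  by rewrite trmx_mul !mulmxA.
rewrite frob_dotMtr !trmx_mul !mulmxA -(mulmxA c P) PP mulmx1 cc mul1mx.
by rewrite -(mulmxA c Q) QQ mulmx1 cc mxtrace1.
Qed.

(** * Monotonicity of projections and jumps of selections *)

(** In the sum of the two minimality inequalities all squared norms cancel, leaving twice the inner
    product. *)
Lemma proj_set_monotone (R : realType) (m n : nat) (C : set 'M[R]_(m, n))
    (Y0 Y1 W0 W1 : 'M[R]_(m, n)) :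
  proj_set C Y0 W0 -> proj_set C Y1 W1 ->
  0 <= frob_dot (Y1 - Y0) (W1 - W0).
Proof.
move=> [CW0 min0] [CW1 min1].
have := min0 _ CW1; have := min1 _ CW0; rewrite !frob_norm_le.
rewrite !frob_dotBl !frob_dotBr !(frob_dotC _ Y0) !(frob_dotC _ Y1).
by lra.
Qed.

Lemma frob_dot_continuous (R : realType) (m n : nat) (A : 'M[R]_(m, n)) :
  continuous (fun M => frob_dot M A).
Proof.
under eq_fun do rewrite frob_dotE.
move=> M; have add_cont := @add_continuous R^o.
apply: (cvg_big add_cont (F := nbhs M)) => j _.
apply: (cvg_big add_cont (F := nbhs M)) => i _.
apply: (cvgM (F := nbhs M)); first exact: coord_continuous.
exact: cvg_cst.
Qed.

Lemma selection_discontinuous (R : realType) (m n : nat)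
    (C : set 'M[R]_(m, n)) (X Z W0 W1 : 'M[R]_(m, n)) (t0 : R)
    (s : R -> 'M[R]_(m, n)) :
  0 < t0 -> proj_set C (X + t0 *: Z) W0 -> proj_set C (X + t0 *: Z) W1 ->
  frob_dot Z W0 < frob_dot Z W1 ->
  is_selection (fun t => proj_set C (X + t *: Z)) s ->
  ~ continuous_at_nneg s t0.
Proof.
move=> t0_gt0 PW0 PW1 ltW sel cs.
pose f t := frob_dot (s t) Z; set c0 := frob_dot Z W0; set c1 := frob_dot Z W1.
have mono W t : 0 <= t -> proj_set C (X + t0 *: Z) W ->
    0 <= (t - t0) * (f t - frob_dot Z W).
  move=> t_ge0 PW; have /sel Pt : `[0, +oo[%classic t.
    by rewrite /= in_itv /= t_ge0.
  have := proj_set_monotone PW Pt.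
  rewrite opprD addrACA subrr add0r -scalerBl frob_dotZl frob_dotBr.
  by rewrite (frob_dotC Z (s t)).
have cf : f x @[x --> within `[0, +oo[%classic (nbhs t0)] --> f t0.
  exact: (cvg_comp _ _ cs (@frob_dot_continuous R m n Z (s t0))).
have e_gt0 : 0 < (c1 - c0) / 2 by rewrite divr_gt0 // subr_gt0.
have /cvgrPdist_lt /(_ _ e_gt0) := cf.
rewrite near_withinE => -[d /= d_gt0 near_t0].
(* The bound by [t0] keeps [t0 - h] in the domain. Both [f (t0 - h)] and [f (t0 + h)] are within
   half the gap of [f t0], yet they differ by at least [c1 - c0]. *)
pose h := Num.min (d / 2) t0.
have h_gt0 : 0 < h by rewrite lt_min divr_gt0.
have h_lt : h < d by rewrite gt_min; apply/orP; left; lra.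
have h_le : h <= t0 by rewrite ge_min lexx orbT.
have fl : `|f t0 - f (t0 - h)| < (c1 - c0) / 2.
  apply: near_t0 => /=; first by rewrite opprB addrC subrK gtr0_norm.
  by rewrite in_itv /= andbT subr_ge0.
have fr : `|f t0 - f (t0 + h)| < (c1 - c0) / 2.
  apply: near_t0 => /=.
    by rewrite opprD addNKr normrN gtr0_norm.
  by rewrite in_itv /= andbT; lra.
have fl_le : f (t0 - h) <= c0.
  have /(mono W0) : 0 <= t0 - h by lra.
  by move=> /(_ PW0); rewrite -/c0; nra.
have fr_ge : c1 <= f (t0 + h).
  have /(mono W1) : 0 <= t0 + h by lra.
  by move=> /(_ PW1); rewrite -/c1; nra.
move: fl fr; rewrite !ltr_distl; lra.
Qed.

(** * Tangent vectors to the bounded-rank matrices *)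

(** The vector is the derivative at [t = 0] of the curve [(1 + t B) X (1 + t A) + t N], whose rank
    never exceeds [\rank X + \rank N]. *)
Lemma tangent_cone_rank_le (R : realType) (m n r : nat) (X : 'M[R]_(m, n))
    (A : 'M[R]_n) (B : 'M[R]_m) (N : 'M[R]_(m, n)) :
  (\rank X + \rank N <= r)%N ->
  tangent_cone (rank_le R m n r) X (X *m A + B *m X + N).
Proof.
move=> rkr; pose t i : R := harmonic i.
pose V := X *m A + B *m X + N.
pose X_ i := X + (t i *: V + (t i * t i) *: (B *m X *m A)).
have X_E i : X_ i = (1%:M + t i *: B) *m X *m (1%:M + t i *: A) + t i *: N.
  rewrite /X_ /V mulmxDr mulmx1 !mulmxDl mul1mx -!scalemxAr.
  rewrite -!scalemxAl; move: (X *m A) (B *m X) (B *m X *m A) => XA BX BXA.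
  by apply/matrixP => p q; rewrite !mxE; ring.
have ct : t i @[i --> \oo] --> 0 by exact: cvg_harmonic.
exists X_, t; split.
- move=> i; rewrite /rank_le /= X_E; apply: leq_trans rkr.
  apply: leq_trans (mxrank_add _ _) _; apply: leq_add.
    by apply: leq_trans (mxrankM_maxl _ _) _; exact: mxrankM_maxr.
  exact: mxrank_scale.
- rewrite -[X in _ --> X]addr0; apply: cvgD; first exact: cvg_cst.
  rewrite -[X in _ --> X]addr0; apply: cvgD.
    by rewrite -[X in _ --> X](scale0r V); apply: cvgZr_tmp.
  rewrite -[X in _ --> X](scale0r (B *m X *m A)); apply: cvgZr_tmp.
  by rewrite -[X in _ --> X](mul0r 0); apply: cvgM.
- by move=> i; rewrite /t /harmonic invr_gt0.
- have -> : (fun i => (t i)^-1 *: (X_ i - X)) =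
            (fun i => V + t i *: (B *m X *m A)).
    apply/funext => i; have t0 : t i != 0 by rewrite invr_eq0.
    rewrite /X_ addrC addKr scalerDr scalerK //; congr (_ + _).
    by rewrite scalerA mulrA mulVf ?mul1r.
  rewrite -[X in _ --> X]addr0; apply: cvgD; first exact: cvg_cst.
  by rewrite -[X in _ --> X](scale0r (B *m X *m A)); apply: cvgZr_tmp.
Qed.

(** * Separating two projections of the same point *)

Lemma delta_row_dot (R : realType) (k : nat) (i j : 'I_k) :
  delta_mx 0 i *m (delta_mx 0 j)^T = (i == j)%:R%:M :> 'M[R]_1.
Proof.
rewrite trmx_delta; case: eqVneq => [<-|ij].
  by rewrite mul_delta_mx; apply/matrixP => a b; rewrite !ord1 !mxE.
by rewrite mul_delta_mx_0 // ?mulr0n raddf0.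
Qed.

(** On the projections given by unit rows [c], the form [frob_dot G] is a constant minus a quadratic
    form in [c]; flipping the sign of one coordinate of [c] changes only the cross term, which is
    nonzero by assumption. *)
Lemma partial_isometry_proj_separated (R : realType) (m n k r : nat)
    (P : 'M[R]_(k, m)) (Q : 'M[R]_(k, n)) (G : 'M[R]_(m, n)) (i j : 'I_k) :
  P *m P^T = 1%:M -> Q *m Q^T = 1%:M -> k = r.+1 -> i != j ->
  \tr (row i P *m G *m (row j Q)^T + row j P *m G *m (row i Q)^T) != 0 ->
  exists W0 W1 : 'M[R]_(m, n),
    [/\ proj_set (rank_le R m n r) (P^T *m Q) W0,
        proj_set (rank_le R m n r) (P^T *m Q) W1 &
        frob_dot G W0 < frob_dot G W1].
Proof.
move=> PP QQ kr ij; rewrite !rowE.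
set ei : 'rV[R]_k := delta_mx 0 i; set ej : 'rV[R]_k := delta_mx 0 j.
pose K := P *m G *m Q^T.
rewrite !trmx_mul !mulmxA -!(mulmxA _ P) -!(mulmxA _ (P *m G)) -/K.
have eii : ei *m ei^T = 1%:M by rewrite delta_row_dot eqxx.
have ejj : ej *m ej^T = 1%:M by rewrite delta_row_dot eqxx.
have eij : ei *m ej^T = 0 by rewrite delta_row_dot (negPf ij) ?mulr0n raddf0.
have eji : ej *m ei^T = 0.
  by rewrite delta_row_dot eq_sym (negPf ij) ?mulr0n raddf0.
clearbody ei ej.
(* By Pythagoras (3, 4, 5), c is a unit row for a = 4/5 and a = -4/5. *)
pose c (a : R) := (3 / 5) *: ei + a *: ej.
have c_form a M : c a *m M *m (c a)^T =
    (3 / 5 * (3 / 5)) *: (ei *m M *m ei^T) + (a ^+ 2) *: (ej *m M *m ej^T) +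
    (3 / 5 * a) *: (ei *m M *m ej^T + ej *m M *m ei^T).
  rewrite /c linearD !linearZ /= !mulmxDl !mulmxDr -!scalemxAl -!scalemxAr.
  rewrite !scalerA; move: (ei *m M *m ei^T) (ei *m M *m ej^T).
  move: (ej *m M *m ei^T) (ej *m M *m ej^T) => Mji Mjj Mii Mij.
  by apply/matrixP => u v; rewrite !mxE; ring.
pose W a := P^T *m (1%:M - (c a)^T *m c a) *m Q.
have PW a : a ^+ 2 = (4 / 5) ^+ 2 ->
    proj_set (rank_le R m n r) (P^T *m Q) (W a).
  move=> a2; apply: partial_isometry_proj => //.
  rewrite -[X in X *m _]mulmx1 c_form !mulmx1 eii ejj eij eji addr0 scaler0.
  by rewrite addr0 -scalerDl a2 (_ : _ + _ = 1) ?scale1r //; field.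
have GW a : frob_dot G (W a) =
    frob_dot G (P^T *m Q) - \tr (c a *m K *m (c a)^T).
  rewrite /W mulmxBr mulmx1 mulmxBl frob_dotBr; congr (_ - _).
  have -> : P^T *m ((c a)^T *m c a) *m Q = (c a *m P)^T *m (c a *m Q).
    by rewrite trmx_mul !mulmxA.
  by rewrite frob_dotMtr trmx_mul !mulmxA.
set z := _ + _ => z0.
have W_neq : frob_dot G (W (4 / 5)) != frob_dot G (W (- (4 / 5))).
  rewrite !GW !c_form -/z !mxtraceD !mxtraceZ -subr_eq0.
  move: z0 (\tr (ei *m K *m ei^T)) (\tr (ej *m K *m ej^T)).
  clear; move: (\tr _) (frob_dot _ _) => u w u0 x y.
  rewrite (_ : _ - _ = - (24 / 25) * u); last by field.
  by rewrite mulf_neq0 // oppr_eq0 mulf_neq0 // ?invr_eq0 pnatr_eq0.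
have PWp := PW (4 / 5) (erefl _); have PWn := PW (- (4 / 5)) (sqrrN _).
move: W_neq; rewrite neq_lt => /orP[] ltW.
  by exists (W (4 / 5)), (W (- (4 / 5))).
by exists (W (- (4 / 5))), (W (4 / 5)).
Qed.

(** * Choice of the tangent direction *)

Theorem proposition3 (R : realType) (m n r : nat)
    (hm : (0 < m)%N) (hn : (0 < n)%N) (hr : (0 < r)%N)
    (hrmn : (r < minn m n)%N)
    (X : 'M[R]_(m, n)) (hX : (rank_le R m n r `\ (0 : 'M[R]_(m, n))) X)
    (tstar : R) (htstar : 0 < tstar) :
  exists Z : 'M[R]_(m, n),
    tangent_cone (rank_le R m n r) X Z /\
    forall s : R -> 'M[R]_(m, n),
      is_selection (fun t => proj_set (rank_le R m n r) (X + t *: Z)) s ->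
      ~ continuous_at_nneg s tstar.
Proof.
have rkX : (\rank X <= r)%N by case: hX.
have rkX0 : (0 < \rank X)%N by rewrite lt0n mxrank_eq0; case: hX => _ /eqP.
have {hrmn}[r_m r_n] : (r < m /\ r < n)%N by move: hrmn; rewrite leq_min => /andP.
set rho := \rank X in rkX rkX0.
(* [P1] is an orthonormal basis of the column space of [X], grown from the empty family; [PN] then
   pads it to [r] rows. *)
have [||P1 [P1X P1P1 _]] := @orthonormal_extend _ _ _ _ rho (0 : 'M[R]_(0, m)) X^T.
- by apply/matrixP => - [].
- by rewrite mxrank_tr.
have [|PN [_ PNPN P1PN]] := @orthonormal_extend _ _ _ _ (r - rho) P1 1%:M P1P1.
  by rewrite mxrank1; lia.
pose P2 := col_mx P1 PN.
have P2P2 : P2 *m P2^T = 1%:M by exact: col_mx_orthonormal.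
have [|pr [_ prpr P2pr]] := @orthonormal_extend _ _ _ _ 1 P2 1%:M P2P2.
  by rewrite mxrank1; lia.
pose P := col_mx P2 pr.
have PP : P *m P^T = 1%:M by exact: col_mx_orthonormal.
pose i0 : 'I_rho := Ordinal rkX0; pose p := row i0 P1.
(* As [p = z *m X^T], the vanishing of [p *m X] would force [p *m p^T = 0]. *)
have pX0 : p *m X != 0.
  apply/eqP => pX0; have /submxP[z pz] : (p <= X^T)%MS.
    by apply: submx_trans P1X; exact: row_sub.
  have : p *m p^T = 1%:M.
    rewrite /p rowE trmx_mul mulmxA -(mulmxA _ P1) P1P1 mulmx1.
    by rewrite delta_row_dot eqxx.
  rewrite {2}pz trmx_mul trmxK mulmxA pX0 mul0mx => /matrixP/(_ 0 0)/eqP.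
  by rewrite !mxE eq_sym oner_eq0.
have [q0 /submxP[b q0b] q0q0] := exists_unit_row pX0.
have [|Q2 [_ Q2Q2 q0Q2]] :=
    @orthonormal_extend _ _ _ _ (rho + (r - rho)) q0 1%:M q0q0.
  by rewrite mxrank1; lia.
pose Q := col_mx Q2 q0.
have QQ : Q *m Q^T = 1%:M.
  apply: col_mx_orthonormal => //.
  by rewrite -[Q2 *m _]trmxK trmx_mul trmxK q0Q2 trmx0.
have [E1 P1E] : exists E1, P1^T = X *m E1.
  by have /submxP[E E_def] := P1X; exists E^T; rewrite E_def trmx_mul trmxK.
(* By equality of ranks [P1] spans all of the column space of [X], so [pr] is orthogonal to it. *)
have prX : pr *m X = 0.
  have P1pr : P1 *m pr^T = 0.
    by move/(congr1 usubmx): P2pr; rewrite mul_col_mx col_mxKu linear0.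
  have /submxP[D XD] : (X^T <= P1)%MS.
    rewrite -(geq_leqif (mxrank_leqif_sup P1X)) mxrank_tr.
    by rewrite (eqP (_ : row_free P1)) //; apply/row_freeP; exists P1^T.
  by apply: trmx_inj; rewrite trmx_mul XD -mulmxA P1pr mulmx0 trmx0.
pose Y := P^T *m Q.
(* The blocks of [P^T *m Q]: [P1^T] factors through [X] on the left, [q0] through [X] on the right,
   and only the [r - rho] rows of [PN] add rank. *)
have YE : Y - X = X *m (E1 *m usubmx Q2 - 1%:M) + (pr^T *m b *m p) *m X
                  + PN^T *m dsubmx Q2.
  rewrite /Y /P /Q /P2 !tr_col_mx mul_row_col -{1}[Q2]vsubmxK mul_row_col.
  rewrite P1E mulmxBr mulmx1 q0b !mulmxA.
  by rewrite [LHS](ACl (1*4*3*2)).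
have tZ : tstar != 0 by rewrite gt_eqF.
pose Z := tstar^-1 *: (Y - X).
have XZ : X + tstar *: Z = Y.
  by rewrite scalerA mulfV // scale1r addrC subrK.
exists Z; split.
  rewrite /Z YE !scalerDr scalemxAr scalemxAl; apply: tangent_cone_rank_le.
  apply: (@leq_trans (rho + (r - rho))); last by lia.
  rewrite leq_add2l; apply: leq_trans (mxrank_scale _ _) _.
  by apply: leq_trans (mxrankM_maxr _ _) _; exact: rank_leq_row.
pose i : 'I_(rho + (r - rho) + 1) := lshift 1 (lshift _ i0).
pose j : 'I_(rho + (r - rho) + 1) := rshift _ ord0.
have rowiP : row i P = p by rewrite !rowKu.
have rowjP : row j P = pr by rewrite rowKd row_id.
have rowjQ : row j Q = q0 by rewrite rowKd row_id.
have Y_off a b' : a != b' -> row a P *m Y *m (row b' Q)^T = 0.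
  move=> ab; rewrite !rowE trmx_mul /Y !mulmxA -(mulmxA _ P) PP mulmx1.
  by rewrite -(mulmxA _ Q) QQ mulmx1 delta_row_dot (negPf ab) ?mulr0n raddf0.
have ij : i != j by rewrite eq_lrshift.
have ji : j != i by rewrite eq_rlshift.
(* The off-diagonal entries of [P *m Y *m Q^T = 1] vanish and [pr] kills [X], so only a multiple of
   [p *m X *m q0^T] is left; it is nonzero because [q0] is a unit multiple of [p *m X]. *)
have Zij : \tr (row i P *m Z *m (row j Q)^T + row j P *m Z *m (row i Q)^T) != 0.
  rewrite /Z -!scalemxAr -!scalemxAl !mulmxBr !mulmxBl !Y_off //.
  rewrite rowiP rowjP rowjQ prX mul0mx subr0 scaler0 addr0 sub0r.
  rewrite mxtraceZ mulf_neq0 ?invr_eq0 //; apply/eqP; rewrite trace_mx11 => h.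
  have pXq0 : p *m X *m q0^T = 0.
    rewrite [LHS]mx11_scalar; move: h; rewrite mxE => /eqP.
    by rewrite oppr_eq0 => /eqP->; rewrite raddf0.
  move: q0q0; rewrite {1}q0b -mulmxA pXq0 mulmx0.
  by move=> /matrixP/(_ 0 0)/eqP; rewrite !mxE eq_sym oner_eq0.
have k_r : (rho + (r - rho) + 1 = r.+1)%N by lia.
have [W0 [W1 [PW0 PW1 ltW]]] := partial_isometry_proj_separated PP QQ k_r ij Zij.
move=> s; rewrite -/Y -XZ in PW0 PW1.
exact: (selection_discontinuous htstar PW0 PW1 ltW).
Qed.
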